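(* Let $F:\mathbb{R}^n\to\mathbb{R}^m$ be continuously differentiable with Lipschitz Jacobian, let $c:\mathbb{R}^m\to\mathbb{R}$ be globally Lipschitz and Hadamard directionally differentiable (as defined in the context), and let $h:=c\circ F$ be bounded below on $\mathbb{R}^n$, with $h^*:=\inf_{x\in\mathbb{R}^n}h(x)$. Let $\rho>0$, and let $\{x^k\}$, $\{z^{k+1}\}$ be generated by the augmented algorithm described in the context (with $C=\mathbb{R}^n$) with an oracle whose outputs $z^{k+1}$ satisfy, for every $k$, the model decrease condition $$m^k(z^{k+1})\le m^k(x^k)=h(x^k),\qquad m^k(y):=c\bigl(F(x^k)+\nabla F(x^k)(y-x^k)\bigr)+\frac{\rho}{2}\|y-x^k\|^2,$$ and the quadratic decrease inequality $$h(x^k)-h(z^{k+1})\ge\alpha\|z^{k+1}-x^k\|^2$$ for some $\alpha>0$ (independent of $k$). Then, after $N\ge1$ iterations, $$\min_{0\le k\le N-1}\|x^k-z^{k+1}\|\le\sqrt{\frac{h(x^0)-h^*}{\alpha N}}.$$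
   Context: Hadamard directional differentiability of $c$: for every $v,w\in\mathbb{R}^m$ the limit $c'(v;w):=\lim_{(t,w')\to(0^+,w)}\frac{c(v+tw')-c(v)}{t}$ exists, and for each fixed $v$ the map $w\mapsto c'(v;w)$ is continuous on $\mathbb{R}^m$. $\nabla F(x)$ denotes the $m\times n$ Jacobian. Augmented algorithm (for $C=\mathbb{R}^n$). Given $x^0\in\mathbb{R}^n$, $\gamma>0$ and $r\in(0,\infty)$, for $k=0,1,2,\dots$: 1. Sample a direction $v^k_{ex}$ from a distribution with support the unit sphere $S^{n-1}$ and a step size $\hat t^k$ from a distribution with support $[0,r]$. 2. Set $t^k_{ex}:=\hat t^k$ if $h(x^k+\hat t^k v^k_{ex})+\frac{\gamma}{2}(\hat t^k)^2<h(x^k)$, and $t^k_{ex}:=0$ otherwise. Set $y^{k+1}:=x^k+t^k_{ex}v^k_{ex}$. 3. Let $z^{k+1}$ be the oracle output at $x^k$. 4. Choose $x^{k+1}\in\arg\min_{u\in\{y^{k+1},z^{k+1}\}}h(u)$. The bound holds for every realization of the samples. *)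

(* Defs.v *)
From mathcomp Require Import all_boot all_order all_algebra.
From mathcomp Require Import all_classical all_reals all_analysis.

Set Implicit Arguments.
Unset Strict Implicit.
Unset Printing Implicit Defensive.

Import Order.TTheory GRing.Theory Num.Theory.
Import numFieldNormedType.Exports.

Local Open Scope classical_set_scope.
Local Open Scope ring_scope.

(** Points of R^n are row vectors.  The library norm [`|x|] on ['rV[R]_n] is the
    maximum norm; it only enters through topological notions and the library's
    [lipschitz] (existence of some Lipschitz constant), none of which depends on
    the choice of norm in finite dimension.  All quantitative norms are the
    Euclidean [enorm]. *)
Definition enorm (R : realType) (n : nat) (x : 'rV[R]_n) : R :=
  Num.sqrt (\sum_(i < n) x ord0 i ^+ 2).

Definition unit_sphere (R : realType) (n : nat) : set 'rV[R]_n :=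
  [set v | enorm v = 1].

Section HadamardDirectionalDerivative.
Context {R : realType} {m : nat}.
Implicit Types (c : 'rV[R]_m -> R) (v w : 'rV[R]_m).

(** The filter of (t, w') -> (0+, w) is the product of the right neighbourhoods
    of 0 with the neighbourhoods of w (w' = w included). *)
Definition hadamard_quotient c v w : set_system R :=
  (c (v + p.1 *: p.2) - c v) / p.1 @[p --> filter_prod (0 : R)^'+ (nbhs w)].

Definition hadamard_derivative c v w : R := lim (hadamard_quotient c v w).

Definition hadamard_differentiable c : Prop :=
  (forall v w, cvg (hadamard_quotient c v w)) /\
  (forall v, continuous (hadamard_derivative c v)).

End HadamardDirectionalDerivative.

Definition continuously_differentiable (R : realType) (n m : nat)
    (F : 'rV[R]_n -> 'rV[R]_m) : Prop :=
  (forall x, differentiable F x) /\ continuous (jacobian F).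

(** With row vectors the library's ['J F x] is n x m, the transpose of the usual
    Jacobian, and acts on the right. *)
Definition prox_linear_model (R : realType) (n m : nat)
    (F : 'rV[R]_n -> 'rV[R]_m) (c : 'rV[R]_m -> R) (rho : R)
    (x y : 'rV[R]_n) : R :=
  c (F x + (y - x) *m 'J F x) + rho / 2 * enorm (y - x) ^+ 2.

Lemma prox_linear_model_center (R : realType) (n m : nat)
    (F : 'rV[R]_n -> 'rV[R]_m) (c : 'rV[R]_m -> R) (rho : R) (x : 'rV[R]_n) :
  prox_linear_model F c rho x x = (c \o F) x.
Proof.
rewrite /prox_linear_model /enorm subrr mul0mx addr0 big1 => [|i _].
  by rewrite sqrtr0 expr0n mulr0 addr0.
by rewrite mxE expr0n.
Qed.

Definition argmin (R : realType) (T : Type) (A : set T) (f : T -> R) : set T :=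
  [set u | A u /\ forall u', A u' -> f u <= f u'].

(** [augmented_run h gamma r oracle x y z vex that] says that these sequences
    form one realization of the augmented algorithm over the whole of R^n.  The
    random samples [vex k] and [that k] are arbitrary points of the supports
    of their distributions.  [oracle u] is the set of admissible oracle outputs
    at [u], so that the oracle need not be deterministic.  [y 0] and [z 0] are
    unused. *)
Record augmented_run (R : realType) (n : nat) (h : 'rV[R]_n -> R)
    (gamma r : R) (oracle : 'rV[R]_n -> set 'rV[R]_n)
    (x y z vex : nat -> 'rV[R]_n) (that : nat -> R) : Prop := AugmentedRun {
  run_direction : forall k, unit_sphere (vex k);
  run_stepsize : forall k, that k \in `[0, r];
  run_exploration : forall k,
    let tex := if h (x k + that k *: vex k) + gamma / 2 * that k ^+ 2 < h (x k)
               then that k else 0 in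
    y k.+1 = x k + tex *: vex k;
  run_oracle : forall k, oracle (x k) (z k.+1);
  run_selection : forall k, argmin [set y k.+1; z k.+1] h (x k.+1)
}.

(* Main.v *)
(* Step 4 gives h(x^{k+1}) <= h(z^{k+1}), so the oracle decrease telescopes along
   the iterates, whatever the exploratory candidates y^{k+1} are. *)
Require Import Defs.
From mathcomp Require Import all_boot all_order all_algebra.
From mathcomp Require Import all_classical all_reals all_analysis.

Import Order.TTheory GRing.Theory Num.Theory.
Import numFieldNormedType.Exports.

Local Open Scope classical_set_scope.
Local Open Scope ring_scope.

(** Let [M] be the minimum in question. By [augmented_run_le_oracle] and the quadratic decrease,
    each of the [N] iterations lowers [h] by at least [alpha * M ^+ 2]. The total drop is at most
    [h (x 0) - inf (range h)], so [alpha * N * M ^+ 2] is bounded by it. *)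

Lemma enormN (R : realType) (n : nat) (u : 'rV[R]_n) : enorm (- u) = enorm u.
Proof. by congr Num.sqrt; apply: eq_bigr => i _; rewrite mxE sqrrN. Qed.

Lemma augmented_run_le_oracle {R : realType} {n : nat} {h : 'rV[R]_n -> R}
    {gamma r : R} {oracle : 'rV[R]_n -> set 'rV[R]_n}
    {x y z vex : nat -> 'rV[R]_n} {that : nat -> R} :
  augmented_run h gamma r oracle x y z vex that ->
  forall k, h (x k.+1) <= h (z k.+1).
Proof. by move=> run k; have [_] := run_selection run k; apply; right. Qed.

(* The default element of the big minimum is its k = 0 term, so for 1 <= N it is
   the minimum over 0 <= k <= N - 1. *)
Theorem theorem5p2 (R : realType) (n m : nat)
    (F : 'rV[R]_n -> 'rV[R]_m) (c : 'rV[R]_m -> R)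
    (F_C1 : continuously_differentiable F)
    (F_lipschitz_jacobian : lipschitz (jacobian F))
    (c_lipschitz : lipschitz c)
    (c_hadamard : hadamard_differentiable c)
    (h_bounded_below : has_lbound (range (c \o F)))
    (rho gamma r alpha : R)
    (rho_gt0 : 0 < rho) (gamma_gt0 : 0 < gamma) (r_gt0 : 0 < r)
    (alpha_gt0 : 0 < alpha)
    (oracle : 'rV[R]_n -> set 'rV[R]_n)
    (x y z vex : nat -> 'rV[R]_n) (that : nat -> R)
    (run : augmented_run (c \o F) gamma r oracle x y z vex that)
    (model_decrease : forall k : nat,
      prox_linear_model F c rho (x k) (z k.+1)
      <= prox_linear_model F c rho (x k) (x k))
    (quadratic_decrease : forall k : nat,
      (c \o F) (x k) - (c \o F) (z k.+1) >= alpha * enorm (z k.+1 - x k) ^+ 2)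
    (N : nat) (N_ge1 : (1 <= N)%N) :
  \big[Num.min/enorm (x 0%N - z 1%N)]_(0 <= k < N) enorm (x k - z k.+1)
  <= Num.sqrt (((c \o F) (x 0%N) - inf (range (c \o F))) / (alpha * N%:R)).
Proof.
set h := c \o F; set M := \big[_/_]_(_ <= _ < _) _.
have M_le k : (k < N)%N -> M <= enorm (x k - z k.+1).
  by move=> kN; rewrite /M big_mkord; apply: (bigmin_le _ (Ordinal kN)).
have M_ge0 : 0 <= M.
  by rewrite /M big_mkord; apply: le_bigmin => *; apply: sqrtr_ge0.
have step k : (k < N)%N -> alpha * M ^+ 2 <= h (x k) - h (x k.+1).
  move=> kN; apply: (@le_trans _ _ (h (x k) - h (z k.+1))); last first.
    by rewrite lerD2l lerN2 (augmented_run_le_oracle run).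
  apply: le_trans (quadratic_decrease k).
  by rewrite ler_pM2l // -opprB enormN lerXn2r ?nnegrE ?sqrtr_ge0 ?M_le.
have sum_le : alpha * N%:R * M ^+ 2 <= h (x 0%N) - h (x N).
  (* [telescope_sumr] sums the forward differences [h (x k.+1) - h (x k)], hence the change of
     sign. *)
  rewrite -lerN2 opprB -(telescope_sumr (h \o x)) //.
  have -> : - (alpha * N%:R * M ^+ 2) = \sum_(0 <= k < N) - (alpha * M ^+ 2).
    by rewrite sumr_const_nat subn0 mulNrn mulrAC mulr_natr.
  by apply: ler_sum_nat => k /andP[_ kN]; rewrite -lerN2 opprK opprB step.
(* [inf] is a genuine lower bound here because [h_bounded_below] holds. *)
have inf_le : inf (range h) <= h (x N) by apply: ge_inf => //; exists (x N).
(* Since [M] is nonnegative, it is the root of its square, and it suffices to compare radicands. *)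
rewrite -(ger0_norm M_ge0) -sqrtr_sqr ler_wsqrtr //.
rewrite ler_pdivlMr ?mulr_gt0 ?ltr0n // mulrC.
by apply: (le_trans sum_le); rewrite lerD2l lerN2.
Qed.
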